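(* Let $u_0\in\mathcal V_{[0,1]}$, let $\varepsilon>0$ with $\varepsilon^{-1}\notin\sigma(A)$, and let $\tau_n\downarrow0$ be a sequence of positive reals with $\tau_n<\varepsilon$ for all $n$. Let $\hat u$ be the solution to the double-obstacle Allen--Cahn equation (ACE) with fidelity forcing on $[0,\infty)$ with $\hat u(0)=u_0$, and let $u_m^{[\tau_n]}$ be the SDIE iterates with time step $\tau_n$ and initial state $u_0$. Then for each $t\ge0$, as $n\to\infty$, $$u^{[\tau_n]}_{\lceil t/\tau_n\rceil}\to\hat u(t).$$
   Context: Graph setting. $G=(V,E)$ is a finite, simple, undirected, weighted, connected graph without self-loops, with weights $\omega_{ij}\ge0$, $\omega_{ij}=\omega_{ji}$, $\omega_{ii}=0$, and $\omega_{ij}>0$ iff $ij\in E$; it has at least two vertices, so all degrees $d_i:=\sum_{j\in V}\omega_{ij}$ are positive. Fix $r\in[0,1]$. $\mathcal V:=\{u:V\to\mathbb R\}$; for $X\subseteq\mathbb R$, $\mathcal V_X:=\{u:V\to X\}$. For an interval $T$, $\mathcal V_{t\in T}:=\{u:T\to\mathcal V\}$ and $\mathcal V_{X,t\in T}:=\{u:T\to\mathcal V_X\}$. Inner product $\langle u,v\rangle_{\mathcal V}:=\sum_{i\in V}u_iv_id_i^r$ with norm $\|\cdot\|_{\mathcal V}$. Graph Laplacian: $(\Delta u)_i:=d_i^{-r}\sum_{j\in V}\omega_{ij}(u_i-u_j)$. $\mathbf 1$ and $\mathbf 0$ are the constant functions $1$ and $0$ on $V$, $I$ is the identity; $\sigma(F)$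 is the set of eigenvalues of a linear operator $F:\mathcal V\to\mathcal V$. Fidelity. Fixed throughout: $\mu\in\mathcal V_{[0,\infty)}\setminus\{\mathbf 0\}$ and $\tilde f\in\mathcal V_{[0,1]}$. $M:=\operatorname{diag}(\mu)$, $A:=\Delta+M$ (which is invertible), $f:=M\tilde f$. Fidelity forced diffusion: $\mathcal S_tu:=e^{-tA}u+A^{-1}(I-e^{-tA})f$ for $t\ge0$, $u\in\mathcal V$. Subdifferential set. For $u\in\mathcal V$, $\mathcal B(u)=\emptyset$ if $u\notin\mathcal V_{[0,1]}$; for $u\in\mathcal V_{[0,1]}$, $\mathcal B(u)$ is the set of $\beta\in\mathcal V$ such that for each $i\in V$: $\beta_i\in[0,\infty)$ if $u_i=0$, $\beta_i=0$ if $0<u_i<1$, and $\beta_i\in(-\infty,0]$ if $u_i=1$. SDIE scheme with fidelity forcing. For $0<\tau<\varepsilon$, $\lambda:=\tau/\varepsilon$ and initial state $u_0\in\mathcal V_{[0,1]}$, the iterates $(u_m)_{m\ge0}$, $(\beta_m)_{m\ge1}$ are (uniquely) defined by $(1-\lambda)u_{m+1}-\mathcal S_\tau u_m+\frac\lambda2\mathbf 1=\lambda\beta_{m+1}$ with $\beta_{m+1}\in\mathcal B(u_{m+1})$. The superscript $[\tau]$ in $u_m^{[\tau]}$ records the time step $\tau$. Double-obstacle ACE with fidelity forcing. A pair $(u,\beta)\in\mathcal V_{[0,1],t\in T}\times\mathcal V_{t\in T}$ is a solution on the interval $T$ when $u\in H^1_{loc}(T;\mathcal V)\cap C^0(T;\mathcal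 V)$ and for almost every $t\in T$, $\varepsilon\frac{du}{dt}(t)+\varepsilon Au(t)-\varepsilon f+\frac12\mathbf 1-u(t)=\beta(t)$ and $\beta(t)\in\mathcal B(u(t))$; $u$ alone is also called a solution. Here $du/dt$ is the weak derivative and $H^1_{loc}(T;\mathcal V)$ is the set of $u:T\to\mathcal V$ with $u\in H^1((a,b);\mathcal V)$ for all $a,b\in T$. For given $u(0)\in\mathcal V_{[0,1]}$ the solution $u$ on $[0,\infty)$ exists and is unique. *)

(* Defs.v *)
From HB Require Import structures.
From mathcomp Require Import all_boot all_order all_algebra.
From mathcomp Require Import all_classical all_reals all_analysis.
Set Implicit Arguments.
Unset Strict Implicit.
Unset Printing Implicit Defensive.
Import Order.TTheory GRing.Theory Num.Theory.
Import numFieldNormedType.Exports.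
Local Open Scope classical_set_scope.
Local Open Scope ring_scope.

(* The vertex set is 'I_n.+1, functions V -> R are column
   vectors (which carry the library's norm topology), and an operator F acts
   by u |-> F *m u. *)

(* The edge set is { ij | 0 < w i j }. *)
Definition weighted_connected_graph (R : realType) (n : nat)
    (w : 'M[R]_n.+1) : Prop :=
  [/\ forall i j, 0 <= w i j,
      forall i j, w i j = w j i,
      forall i, w i i = 0 &
      forall i j, connect (fun k l => 0 < w k l) i j].

Definition degree (R : realType) (n : nat) (w : 'M[R]_n.+1) (i : 'I_n.+1) : R :=
  \sum_j w i j.

Definition valued_in (R : realType) (n : nat) (X : set R)
    (u : 'cV[R]_n.+1) : Prop :=
  forall i, X (u i 0).

Definition innerV (R : realType) (n : nat) (w : 'M[R]_n.+1) (r : R)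
    (u v : 'cV[R]_n.+1) : R :=
  \sum_i u i 0 * v i 0 * degree w i `^ r.

Definition normV (R : realType) (n : nat) (w : 'M[R]_n.+1) (r : R)
    (u : 'cV[R]_n.+1) : R :=
  Num.sqrt (innerV w r u u).

Definition Delta (R : realType) (n : nat) (w : 'M[R]_n.+1) (r : R)
    (u : 'cV[R]_n.+1) : 'cV[R]_n.+1 :=
  \col_i (degree w i `^ (- r) * \sum_j w i j * (u i 0 - u j 0)).

(* Matrix of Delta in the canonical basis; see laplacian_mulmx. *)
Definition laplacian (R : realType) (n : nat) (w : 'M[R]_n.+1) (r : R) :
    'M[R]_n.+1 :=
  \matrix_(i, j) Delta w r (delta_mx j 0) i 0.

Lemma laplacian_mulmx (R : realType) (n : nat) (w : 'M[R]_n.+1) (r : R)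
    (u : 'cV[R]_n.+1) : laplacian w r *m u = Delta w r u.
Proof.
apply/matrixP => i k; rewrite [k]ord1 !mxE.
under eq_bigr => j _ do rewrite !mxE -mulrA mulr_suml.
rewrite -mulr_sumr exchange_big /=; congr (_ * _).
apply: eq_bigr => l _.
under eq_bigr => j _ do rewrite !mxE eqxx !andbT -mulrA.
rewrite -mulr_sumr; congr (_ * _).
under eq_bigr => j _ do rewrite mulrBl ![_ == j]eq_sym !mulr_natl !mulrb.
by rewrite sumrB -!big_mkcond !big_pred1_eq.
Qed.

(* Stated for column vectors, whereas the library's eigenvalue is about row
   vectors acted on from the right. *)
Definition spectrum (R : realType) (n : nat) (F : 'M[R]_n.+1) : set R :=
  [set l | exists2 v : 'cV[R]_n.+1, v != 0 & F *m v = l *: v].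

Definition expmx (R : realType) (n : nat) (F : 'M[R]_n.+1) : 'M[R]_n.+1 :=
  limn (series (fun k => (k`!%:R)^-1 *: F ^+ k)).

Definition fidelity_mx (R : realType) (n : nat) (mu : 'cV[R]_n.+1) :
    'M[R]_n.+1 :=
  diag_mx mu^T.

Definition opA (R : realType) (n : nat) (w : 'M[R]_n.+1) (r : R)
    (mu : 'cV[R]_n.+1) : 'M[R]_n.+1 :=
  laplacian w r + fidelity_mx mu.

Definition fidelity_diffusion (R : realType) (n : nat) (A : 'M[R]_n.+1)
    (f : 'cV[R]_n.+1) (t : R) (u : 'cV[R]_n.+1) : 'cV[R]_n.+1 :=
  expmx (- t *: A) *m u + invmx A *m (1%:M - expmx (- t *: A)) *m f.

Definition subdiffB (R : realType) (n : nat) (u : 'cV[R]_n.+1) :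
    set 'cV[R]_n.+1 :=
  [set beta | valued_in `[0, 1] u /\
    forall i, [/\ u i 0 = 0 -> 0 <= beta i 0,
                  0 < u i 0 < 1 -> beta i 0 = 0 &
                  u i 0 = 1 -> beta i 0 <= 0]].

(* beta 0 is unconstrained: the sequence (beta_m) starts at m = 1. *)
Definition SDIE_iterates (R : realType) (n : nat) (A : 'M[R]_n.+1)
    (f : 'cV[R]_n.+1) (eps tau : R) (u0 : 'cV[R]_n.+1)
    (u beta : nat -> 'cV[R]_n.+1) : Prop :=
  let lambda := tau / eps in
  u 0%N = u0 /\
  forall m,
    (1 - lambda) *: u m.+1 - fidelity_diffusion A f tau (u m)
      + (lambda / 2) *: const_mx 1 = lambda *: beta m.+1 /\
    subdiffB (u m.+1) (beta m.+1).

Definition test_function (R : realType) (a b : R) (phi : R -> R) : Prop :=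
  [/\ forall k x, derivable (derive1n k phi) x 1,
      compact (closure [set x | phi x != 0]) &
      closure [set x | phi x != 0] `<=` `]a, b[].

(* Functions of time are total on R; only their values on the interval under
   consideration matter. *)
Definition weak_derivative (R : realType) (n : nat) (a b : R)
    (u v : R -> 'cV[R]_n.+1) : Prop :=
  forall i,
    [/\ locally_integrable `]a, b[ (fun t => u t i 0),
        locally_integrable `]a, b[ (fun t => v t i 0) &
        forall phi, test_function a b phi ->
          Rintegral lebesgue_measure `]a, b[ (fun t : R => u t i 0 * derive1 phi t) =
          - Rintegral lebesgue_measure `]a, b[ (fun t : R => v t i 0 * phi t)].

Definition in_L2 (R : realType) (n : nat) (w : 'M[R]_n.+1) (r : R) (a b : R)
    (u : R -> 'cV[R]_n.+1) : Prop :=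
  (forall i, measurable_fun `]a, b[ (fun t => u t i 0)) /\
  (\int[lebesgue_measure]_(t in `]a, b[) (normV w r (u t) ^+ 2)%:E < +oo)%E.

Definition in_H1 (R : realType) (n : nat) (w : 'M[R]_n.+1) (r : R) (a b : R)
    (u : R -> 'cV[R]_n.+1) : Prop :=
  in_L2 w r a b u /\
  exists2 v, weak_derivative a b u v & in_L2 w r a b v.

Definition in_H1loc (R : realType) (n : nat) (w : 'M[R]_n.+1) (r : R)
    (T : interval R) (u : R -> 'cV[R]_n.+1) : Prop :=
  forall a b, a \in T -> b \in T -> in_H1 w r a b u.

Definition ACE_solution (R : realType) (n : nat) (w : 'M[R]_n.+1) (r : R)
    (mu f : 'cV[R]_n.+1) (eps : R) (T : interval R)
    (u beta : R -> 'cV[R]_n.+1) : Prop :=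
  [/\ forall t, t \in T -> valued_in `[0, 1] (u t),
      in_H1loc w r T u,
      {within [set` T], continuous u} &
      exists2 du : R -> 'cV[R]_n.+1,
        forall a b, a \in T -> b \in T -> weak_derivative a b u du &
        {ae lebesgue_measure, forall t : R, t \in T ->
          eps *: du t + eps *: (opA w r mu *m u t) - eps *: f
            + 2^-1 *: const_mx 1 - u t = beta t /\
          subdiffB (u t) (beta t)}].

(* Main.v *)
Require Import Defs.
From HB Require Import structures.
From mathcomp Require Import all_boot all_order all_algebra.
From mathcomp Require Import all_classical all_reals all_analysis.
From mathcomp Require Import measurable_realfun ring lra.
Set Implicit Arguments.
Unset Strict Implicit.
Unset Printing Implicit Defensive.
Import Order.TTheory GRing.Theory Num.Theory.
Import numFieldNormedType.Exports.
Local Open Scope classical_set_scope.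
Local Open Scope ring_scope.

(* The ACE reads u' = D(u) + beta / eps with D(u) := f - A u + (u - 1/2) / eps
   Lipschitz, and the sign of beta only depends on which obstacle u touches.
   Testing the weak derivative against smooth plateau functions shows that the
   slope of a component of u is at most sup D while it is positive, and at
   least inf D while it is below 1; following the component from its last
   contact time, u is Lipschitz and
     u(t + tau) = clamp (u(t) + tau D(u(t))) + O(tau^2),
   where clamp truncates to [0,1].  Since
   exp(-tau A) = I - tau A + O(tau^2), an SDIE step has the same form
   u_(m+1) = clamp (u_m + tau D(u_m)) + O(tau^2), and a discrete Gronwall
   argument in the maximum norm gives an error O(tau). *)

(** * Smooth functions and a smooth transition from 0 to 1 *)

Section smooth.
Context {R : realType}.
Implicit Types (f g : R -> R) (k : nat) (x : R).

(** The recursion peels off the first derivative, so that closure properties follow by induction on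
    [k] with the function generalized; [smooth_derive1n] returns to the iterated derivatives of
    [test_function]. *)
Fixpoint derivable_upto k f : Prop :=
  (forall x, derivable f x 1) /\
  (if k is k'.+1 then derivable_upto k' (derive1 f) else True).

Definition smooth f := forall k, derivable_upto k f.

Lemma derivable_uptoS k f : derivable_upto k.+1 f -> derivable_upto k f.
Proof.
elim: k f => [|k IH] f; first by case=> df _; split.
by move=> [df /IH df']; split.
Qed.

Lemma smooth_derivable f x : smooth f -> derivable f x 1.
Proof. by move=> /(_ 0%N)[+ _]; exact. Qed.

Lemma smooth_derive1 f : smooth f -> smooth (derive1 f).
Proof. by move=> sf k; case: (sf k.+1). Qed.

Lemma smooth_derive1n k f : smooth f -> smooth (derive1n k f).
Proof. by elim: k f => //= k IH f sf; exact/smooth_derive1/IH. Qed.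

Lemma smooth_continuous f : smooth f -> continuous f.
Proof.
move=> sf x; apply: differentiable_continuous.
exact/derivable1_diffP/smooth_derivable.
Qed.

Lemma derivable_uptoD k f g : derivable_upto k f -> derivable_upto k g ->
  derivable_upto k (fun x => f x + g x).
Proof.
elim: k f g => [|k IH] f g [df f'] [dg g'];
  (split; [|try exact: I]).
- by move=> x; apply: derivableD.
- by move=> x; apply: derivableD.
rewrite (_ : derive1 _ = (fun x => derive1 f x + derive1 g x)); first exact: IH.
by apply/funext => x; rewrite !derive1E deriveD.
Qed.

Lemma derivable_uptoZ k c f : derivable_upto k f ->
  derivable_upto k (fun x => c * f x).
Proof.
elim: k f => [|k IH] f [df f'];
  (split; [|try exact: I]).
- by move=> x; apply: derivableZ.
- by move=> x; apply: derivableZ.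
rewrite (_ : derive1 _ = (fun x => c * derive1 f x)); first exact: IH.
by apply/funext => x; rewrite !derive1E deriveZ.
Qed.

Lemma derivable_uptoM k f g : derivable_upto k f -> derivable_upto k g ->
  derivable_upto k (fun x => f x * g x).
Proof.
elim: k f g => [|k IH] f g fk gk.
  case: fk gk => df _ [dg _].
  by split=> [x|]; [exact: derivableM|].
have [df f'] := fk; have [dg g'] := gk.
split; first by move=> x; apply: derivableM.
rewrite (_ : derive1 _ = (fun x => f x * derive1 g x + g x * derive1 f x)).
  by apply: derivable_uptoD; apply: IH => //; exact: derivable_uptoS.
by apply/funext => x; rewrite !derive1E deriveM.
Qed.

(** The derivative of [1 / f] is a product in which [1 / f] recurs, so [f] stays fixed in the
    induction and the induction hypothesis supplies [1 / f] up to order [k]. *)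
Lemma derivable_uptoV k f : (forall x, f x != 0) -> derivable_upto k f ->
  derivable_upto k (fun x => (f x)^-1).
Proof.
move=> f0; elim: k => [|k IH] fk.
  by case: fk => df _; split=> [x|]; [exact: derivableV|].
have [df f'] := fk.
have fVk := IH (derivable_uptoS fk).
split; first by move=> x; apply: derivableV.
rewrite (_ : derive1 _ = (fun x => -1 * (((f x)^-1 * (f x)^-1) * derive1 f x))).
  by apply: derivable_uptoZ; apply: derivable_uptoM => //; apply: derivable_uptoM.
apply/funext => x; rewrite !derive1E deriveV// mulN1r -mulNr.
by congr (- _ * _); rewrite -exprVn expr2.
Qed.

Lemma derive1_affine f c d x : derivable f (c * x + d) 1 ->
  is_derive x 1 (fun y => f (c * y + d)) (c * derive1 f (c * x + d)).
Proof.
move=> df.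
have dg : is_derive x (1 : R) (fun y => c * y + d) c.
  have := @is_deriveD _ _ _ (fun y => c * y) (cst d) x 1 _ _
    (@is_deriveZ _ _ _ id c x 1 _ (is_derive_id x 1)) (is_derive_cst d x 1).
  by move/is_derive_eq; apply; rewrite addr0 scaler1.
have df' : is_derive (c * x + d) 1 f (derive1 f (c * x + d)).
  by rewrite derive1E; exact: derivableP.
have := @is_derive1_comp _ f (fun y => c * y + d) x _ _ df' dg.
by move/is_derive_eq; apply; rewrite mulrC.
Qed.

Lemma derivable_upto_affine k f c d : derivable_upto k f ->
  derivable_upto k (fun x => f (c * x + d)).
Proof.
elim: k f => [|k IH] f [df f'];
  (split; [|try exact: I]).
- by move=> x; have [] := derive1_affine (df (c * x + d)).
- by move=> x; have [] := derive1_affine (df (c * x + d)).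
rewrite (_ : derive1 _ = (fun x => c * derive1 f (c * x + d))).
  by apply: derivable_uptoZ; exact: IH.
by apply/funext => x; rewrite derive1E; have [_ ->] := derive1_affine (df (c * x + d)).
Qed.

(* The family is closed under differentiation up to linear combinations, which
   is what makes it smooth at the origin. *)
Definition flat k : R -> R :=
  fun x => if 0 < x then x^-1 ^+ k * expR (- x^-1) else 0.

Lemma flat_ge0 k x : 0 <= flat k x.
Proof.
rewrite /flat; case: ifPn => // x0.
by rewrite mulr_ge0 ?expR_ge0// exprn_ge0// invr_ge0 ltW.
Qed.

(** With [y = 1 / x], one term of the exponential series gives [y ^+ k.+1 / k.+1! <= expR y]. This
    linear bound controls the difference quotients at the origin. *)
Lemma flat_le k x : 0 <= x -> flat k x <= k.+1`!%:R * x.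
Proof.
rewrite /flat; case: ifPn => [x0 _|_ x0]; last by rewrite mulr_ge0.
have y0 : 0 < x^-1 by rewrite invr_gt0.
rewrite expRN ler_pdivrMr ?expR_gt0//.
have : x^-1 ^+ k.+1 / k.+1`!%:R <= expR x^-1.
  by apply: le_trans (expR_ge1Dxn k (ltW y0)); rewrite lerDr.
rewrite ler_pdivrMr ?ltr0n ?fact_gt0// => h.
have := ler_wpM2l (ltW x0) h.
rewrite exprS mulrA mulfV ?gt_eqF// mul1r => /le_trans; apply.
rewrite le_eqVlt; apply/orP; left; apply/eqP. ring.
Qed.

(** Away from 0 this is the product and chain rule. At 0 the difference quotient vanishes on the
    left and equals [flat k.+1 h] on the right, which tends to 0 by [flat_le]. *)
Lemma is_derive_flat k x :
  is_derive x 1 (flat k) (flat k.+2 x - k%:R * flat k.+1 x).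
Proof.
have [x0|x0|->] := ltrgtP x 0.
- have -> : flat k.+2 x - k%:R * flat k.+1 x = 0.
    by rewrite /flat ltNge ltW//= mulr0 subrr.
  apply: (near_eq_is_derive _ (is_derive_cst (0 : R) x 1)).
  by near=> y; rewrite /flat ifN// -leNgt ltW//; near: y; exact: lt_nbhsl.
- have xV : is_derive x (1 : R) (fun y : R => y^-1) (- (x^-1 ^+ 2)).
    have dV := @derivableV _ _ id x 1 (lt0r_neq0 x0) (@derivable_id _ _ x 1).
    have := @deriveV _ _ id x 1 (lt0r_neq0 x0) (@derivable_id _ _ x 1).
    by move=> h; apply: DeriveDef => //; rewrite h derive_id scaler1 exprVn.
  have d1 := @is_deriveX _ _ (fun y : R => y^-1) k x 1 _ xV.
  have d2 := @is_derive1_comp _ expR (fun y : R => - y^-1) x _ _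
    (is_derive_expR _) (@is_deriveN _ _ _ (fun y : R => y^-1) x 1 _ xV).
  have d3 := @is_deriveM _ _ _ _ x 1 _ _ d1 d2.
  apply: (near_eq_is_derive _ (is_derive_eq d3 _)).
    near=> y; rewrite /flat ifT; last by near: y; exact: lt_nbhsr.
    by rewrite /GRing.mul /= exprfctE.
  rewrite /flat x0 /= exprfctE !opprK /GRing.scale/=.
  case: k {d1 d3} => [|k] /=; first by ring.
  rewrite !exprS.
  ring.
have -> : flat k.+2 0 - k%:R * flat k.+1 0 = 0.
  by rewrite /flat ltxx mulr0 subrr.
have lim0 : (fun h => h^-1 *: ((flat k \o shift (0 : R)) (h *: (1 : R)) - flat k 0)) @ 0^'
    --> (0 : R).
  apply/cvgrPdist_le => e e0; near=> h.
  have h0 : h != 0 by near: h; exact: nbhs_dnbhs_neq.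
  rewrite sub0r normrN /= scaler1 addr0 {2}/flat ltxx subr0.
  have [hp|hn] := ltP 0 h; last by rewrite /flat ltNge hn/= scaler0 normr0 ltW.
  rewrite (_ : _ *: _ = flat k.+1 h); last first.
    by rewrite /flat hp exprS -mulrA.
  rewrite ger0_norm ?flat_ge0//; apply: le_trans (flat_le _ (ltW hp)) _.
  rewrite mulrC -ler_pdivlMr ?ltr0n ?fact_gt0//.
  apply: le_trans (ler_norm _) _.
  near: h; apply: dnbhs0_le.
  by rewrite divr_gt0// ltr0n fact_gt0.
apply: DeriveDef; last by apply: cvg_lim lim0.
by apply/cvg_ex; exists 0.
Unshelve. all: by end_near. Qed.

Lemma smooth_flat k : smooth (flat k).
Proof.
move=> j; elim: j k => [|j IH] k; (split; [|try exact: I]).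
- by move=> x; have [] := is_derive_flat k x.
- by move=> x; have [] := is_derive_flat k x.
rewrite (_ : derive1 _ = (fun x => flat k.+2 x + (- k%:R) * flat k.+1 x)).
  by apply: derivable_uptoD; [exact: IH|apply: derivable_uptoZ; exact: IH].
by apply/funext => x; rewrite derive1E mulNr; have [_ ->] := is_derive_flat k x.
Qed.

(** The classical smooth transition function: 0 up to 0, 1 from 1 on. The denominator is positive
    because [x] and [1 - x] are never both nonpositive. *)
Definition step (x : R) : R := flat 0 x / (flat 0 x + flat 0 (1 - x)).

Lemma flat_gt0 k x : 0 < x -> 0 < flat k x.
Proof. by move=> x0; rewrite /flat x0 mulr_gt0 ?expR_gt0// exprn_gt0// invr_gt0. Qed.

Lemma flat_le0 k x : x <= 0 -> flat k x = 0.
Proof. by move=> x0; rewrite /flat ltNge x0. Qed.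

Lemma flat0_nondecreasing (x y : R) : x <= y -> flat 0 x <= flat 0 y.
Proof.
move=> xy; have [x0|x0] := leP x 0; first by rewrite (flat_le0 _ x0) flat_ge0.
have y0 := lt_le_trans x0 xy.
by rewrite /flat x0 y0 !expr0 !mul1r ler_expR lerN2 lef_pV2.
Qed.

Lemma step_den_gt0 (x : R) : 0 < flat 0 x + flat 0 (1 - x).
Proof.
have [x0|x0] := leP x 0; last by rewrite ltr_pwDl ?flat_gt0 ?flat_ge0.
by rewrite ltr_wpDl ?flat_ge0// flat_gt0// subr_gt0 (le_lt_trans x0).
Qed.

Lemma smooth_step : smooth step.
Proof.
move=> k; apply: derivable_uptoM; first exact: smooth_flat.
apply: derivable_uptoV; first by move=> x; rewrite gt_eqF// step_den_gt0.
apply: derivable_uptoD; first exact: smooth_flat.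
rewrite (_ : (fun x => _) = (fun x => flat 0 (-1 * x + 1))); last first.
  by apply/funext => x; rewrite mulN1r addrC.
exact/derivable_upto_affine/smooth_flat.
Qed.

Lemma step_eq0 (x : R) : x <= 0 -> step x = 0.
Proof. by move=> x0; rewrite /step (flat_le0 _ x0) mul0r. Qed.

Lemma step_eq1 (x : R) : 1 <= x -> step x = 1.
Proof.
move=> x1; rewrite /step [flat 0 (1 - x)]flat_le0 ?subr_le0// addr0 divff//.
by rewrite gt_eqF// flat_gt0// (lt_le_trans ltr01).
Qed.

(** Cross-multiplying and cancelling the common product leaves [flat 0 x * flat 0 (1 - y) <= flat 0
    y * flat 0 (1 - x)]. *)
Lemma step_nondecreasing (x y : R) : x <= y -> step x <= step y.
Proof.
move=> xy; rewrite /step ler_pdivrMr ?step_den_gt0// mulrAC.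
rewrite ler_pdivlMr ?step_den_gt0// !mulrDr mulrC lerD2l.
rewrite mulrC [leRHS]mulrC; apply: ler_pM; rewrite ?flat_ge0//.
  by apply: flat0_nondecreasing; rewrite lerD2l lerN2.
exact: flat0_nondecreasing.
Qed.

End smooth.

(** * From almost-everywhere bounds on a weak derivative to slope bounds *)

Section weak_derivative.
Context {R : realType}.
Local Notation mu := (@lebesgue_measure R).

(** The difference [g - f] agrees almost everywhere with its positive part, whose integral is
    nonnegative. *)
Lemma ae_le_Rintegral (D : set R) (f g : R -> R) : measurable D ->
  mu.-integrable D (EFin \o f) -> mu.-integrable D (EFin \o g) ->
  {ae mu, forall x, D x -> f x <= g x} ->
  \int[mu]_(x in D) f x <= \int[mu]_(x in D) g x.
Proof.
move=> mD fi gi fg.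
have mf : measurable_fun D f by apply/measurable_EFinP; case/integrableP: fi.
have mg : measurable_fun D g by apply/measurable_EFinP; case/integrableP: gi.
rewrite -subr_ge0 -RintegralB//.
rewrite (_ : Rintegral _ _ _ = \int[mu]_(x in D) Num.max (g x - f x) 0).
  by apply: Rintegral_ge0 => x _; rewrite le_max lexx orbT.
congr fine; apply: ae_eq_integral => //.
- exact/measurable_EFinP/measurable_funB.
- by apply/measurable_EFinP/measurable_maxr => //; exact: measurable_funB.
apply: (@filterS _ _ (ae_filter_ringOfSetsType mu) _ _ _ fg) => x fgx Dx.
congr EFin.
by rewrite max_l// subr_ge0 fgx.
Qed.

(** The transition [step] rescaled to the interval from [a] to [a + d], written in the affine form
    that [derivable_upto_affine] expects. *)
Definition ramp (a d x : R) : R := step (d^-1 * x + (- a / d)).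

Lemma smooth_ramp a d : smooth (ramp a d).
Proof. by move=> k; apply: derivable_upto_affine; exact: smooth_step. Qed.

Lemma rampE a d x : ramp a d x = step ((x - a) / d).
Proof. by rewrite /ramp; congr step; ring. Qed.

Lemma ramp_eq0 a d x : 0 < d -> x <= a -> ramp a d x = 0.
Proof.
by move=> d0 xa; rewrite rampE step_eq0// pmulr_lle0 ?invr_gt0// subr_le0.
Qed.

Lemma ramp_eq1 a d x : 0 < d -> a + d <= x -> ramp a d x = 1.
Proof.
by move=> d0 xa; rewrite rampE step_eq1// ler_pdivlMr// mul1r lerBrDl.
Qed.

Lemma ramp_nondecreasing a d : 0 < d -> {homo ramp a d : x y / x <= y}.
Proof.
move=> d0 x y xy; rewrite !rampE; apply: step_nondecreasing.
by rewrite ler_pM2r ?invr_gt0// lerD2r.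
Qed.

Lemma ramp_derive1_eq0 a d x : 0 < d -> x < a \/ a + d < x ->
  derive1 (ramp a d) x = 0.
Proof.
move=> d0 h; rewrite derive1E.
case: h => h.
  rewrite (near_eq_derive (g := cst (0 : R))) ?derive_cst//.
  by near=> y; rewrite ramp_eq0// ltW//; near: y; exact: lt_nbhsl.
rewrite (near_eq_derive (g := cst (1 : R))) ?derive_cst//.
by near=> y; rewrite ramp_eq1// ltW//; near: y; exact: lt_nbhsr.
Unshelve. all: by end_near. Qed.

(** Adding [e * y] makes the function strictly increasing, as [incr_derive1_ge0] requires; then [e]
    tends to 0. *)
Lemma nondecreasing_derive1_ge0 (f : R -> R) x : (forall y, derivable f y 1) ->
  {homo f : y z / y <= z} -> 0 <= derive1 f x.
Proof.
move=> df fnd; apply/ler_addgt0Pr => e e0.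
have dfe y : is_derive y (1 : R) (fun y => f y + e * y) (derive1 f y + e).
  have -> : derive1 f y + e = 'D_1 f y + e *: 1 by rewrite derive1E scaler1.
  exact: (@is_deriveD _ _ _ f (fun y => e * y) y 1 _ _ (derivableP (df y))
    (@is_deriveZ _ _ _ id e y 1 _ (is_derive_id y 1))).
have := @incr_derive1_ge0 R (fun y => f y + e * y) setT x.
rewrite derive1E; have [_ ->] := dfe x; apply.
- by move=> y _; have [] := dfe y.
- move=> y z _ _ yz; apply: ler_ltD; first exact/fnd/ltW.
  by rewrite ltr_pM2l.
- by rewrite interiorT.
Qed.

Lemma ramp_derive1_ge0 a d x : 0 < d -> 0 <= derive1 (ramp a d) x.
Proof.
move=> d0; apply: nondecreasing_derive1_ge0; last exact: ramp_nondecreasing.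
by move=> y; apply: smooth_derivable; exact: smooth_ramp.
Qed.

(** The product vanishes off the compact support of [phi], on which [p] is integrable and [phi] is
    bounded. *)
Lemma integrable_test_function (p phi : R -> R) (s t : R) :
  locally_integrable `]s, t[ p -> test_function s t phi ->
  mu.-integrable `]s, t[ (EFin \o (fun x => p x * phi x)).
Proof.
move=> [mp _ ip] [dphi cK Kst]; set K := closure _ in cK Kst.
have cphi : continuous phi.
  by move=> x; apply: differentiable_continuous; exact/derivable1_diffP/(dphi 0%N).
have mK : measurable K by exact: compact_measurable.
rewrite (_ : EFin \o _ = (EFin \o (fun x => p x * phi x)) \_ K); last first.
  apply/funext => x; rewrite patchE; case: ifPn => // /negP xK.
  rewrite /= (_ : phi x = 0) ?mulr0//; apply: contrapT => /eqP phix.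
  by apply: xK; rewrite inE; exact: subset_closure.
apply/integrable_restrict => //; rewrite setIidr//.
apply: (@integrableMl _ _ _ mu _ _ (EFin \o p) phi) => //.
- apply/integrableP; split; last exact: ip.
  apply/measurable_EFinP.
  apply: (@measurable_funS _ _ _ _ `]s, t[%classic _ _ _ Kst mp).
  exact: measurable_itv.
- by apply: measurable_funTS; exact: (continuous_measurable_fun cphi).
- have [M [Mr HM]] : bounded_set (phi @` K).
    by apply/compact_bounded/continuous_compact => //; exact: continuous_subspaceT.
  by exists M; split => // x Mx y yK; apply: HM => //; exists y.
Qed.

(* With [W x := f x - c * x] the claim is [W t <= W s].  Otherwise [W <= c1]
   near [s] and [c2 <= W] near [t] with [c1 < c2], and testing against
   [phi], a plateau that rises near [s] and falls near [t], yields
   [0 <= \int W phi' <= c1 - c2]. *)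
Lemma weak_derivative_le (f p : R -> R) (s t c : R) : s < t ->
  {within `[s, t], continuous f} ->
  locally_integrable `]s, t[ p ->
  (forall phi, test_function s t phi ->
    \int[mu]_(x in `]s, t[) (f x * derive1 phi x) =
    - \int[mu]_(x in `]s, t[) (p x * phi x)) ->
  {ae mu, forall x, x \in `]s, t[ -> p x <= c} ->
  f t - f s <= c * (t - s).
Proof.
move=> st cf lip weak pc; rewrite leNgt; apply/negP => ct.
pose W (x : R) := f x - c * x.
have Wst : W s < W t by rewrite /W; lra.
pose c1 := (2 * W s + W t) / 3; pose c2 := (W s + 2 * W t) / 3.
have [Wc1 c12 Wc2] : [/\ W s < c1, c1 < c2 & c2 < W t].
  by rewrite /c1 /c2; split; lra.
have [fst fs ft] := (continuous_within_itvP f st).1 cf.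
have cl : continuous (fun x : R => c * x) by move=> x; exact: mulrl_continuous.
have Ws : W @ s^'+ --> W s by apply: cvgB => //; apply: cvg_at_right_filter; exact: cl.
have Wt : W @ t^'- --> W t by apply: cvgB => //; apply: cvg_at_left_filter; exact: cl.
have [d [d0 d4 dW1 dW2]] : exists d : R, [/\ 0 < d, 4 * d <= t - s,
    forall x : R, s < x <= s + 2 * d -> W x <= c1 &
    forall x : R, t - 2 * d <= x < t -> c2 <= W x].
  have [e1 /= e10 W1] : \forall x \near s^'+, W x <= c1 by exact: cvgr_le Ws _ Wc1.
  have [e2 /= e20 W2] : \forall x \near t^'-, c2 <= W x by exact: cvgr_ge Wt _ Wc2.
  (* A quarter of the minimum keeps the points within [2 * d] of an endpoint inside the
     corresponding window, and leaves room for both flanks of the plateau. *)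
  pose d := Num.min (t - s) (Num.min e1 e2) / 4.
  have m0 : 0 < Num.min (t - s) (Num.min e1 e2) by rewrite !lt_min subr_gt0 st e10 e20.
  have [m1 m2 m3] : [/\ 4 * d <= t - s, 4 * d <= e1 & 4 * d <= e2].
    by split; rewrite /d mulrC divfK// !ge_min lexx ?orbT.
  have d0 : 0 < d by rewrite divr_gt0.
  exists d; split => // x /andP[h1 h2].
    by apply: W1 => //=; rewrite distrC ger0_norm; lra.
  by apply: W2 => //=; rewrite ger0_norm; lra.
(* [phi1] rises between [s + d] and [s + 2 * d], [phi2] between [t - 2 * d] and [t - d]; their
   difference is the plateau. *)
pose phi1 := ramp (s + d) d; pose phi2 := ramp (t - 2 * d) d.
pose phi (x : R) := phi1 x + (- 1) * phi2 x.
have sphi : smooth phi.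
  move=> k; apply: derivable_uptoD; first exact: smooth_ramp.
  by apply: derivable_uptoZ; exact: smooth_ramp.
have phi0 (x : R) : x <= s + d \/ t - d <= x -> phi x = 0.
  move=> h; rewrite /phi mulN1r /phi1 /phi2; case: h => h.
    by rewrite !ramp_eq0 ?subrr//; lra.
  by rewrite !ramp_eq1 ?subrr//; lra.
have tphi : test_function s t phi.
  have clphi : closure [set x | phi x != 0] `<=` `[s + d, t - d].
    have /closure_id -> : closed [set` `[s + d, t - d]] by exact: interval_closed.
    apply: closure_subset => x /= /eqP phix; rewrite in_itv/=; apply/andP; split.
      by rewrite leNgt; apply/negP => h; apply: phix; apply: phi0; left; exact: ltW.
    by rewrite leNgt; apply/negP => h; apply: phix; apply: phi0; right; exact: ltW.
  split.
  - by move=> k x; apply: smooth_derivable; exact: smooth_derive1n.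
  - apply: subclosed_compact clphi; first exact: closed_closure.
    exact: segment_compact.
  - apply: subset_trans clphi _ => x /=; rewrite !in_itv/= => /andP[h1 h2].
    by apply/andP; split; lra.
have phi_ge0 (x : R) : 0 <= phi x.
  rewrite /phi mulN1r subr_ge0 /phi1 /phi2 !rampE; apply: step_nondecreasing.
  by rewrite ler_pM2r ?invr_gt0//; lra.
have d1 (x : R) : is_derive x 1 phi1 (derive1 phi1 x).
  by rewrite derive1E; apply: derivableP; apply: smooth_derivable; exact: smooth_ramp.
have d2 (x : R) : is_derive x 1 phi2 (derive1 phi2 x).
  by rewrite derive1E; apply: derivableP; apply: smooth_derivable; exact: smooth_ramp.
have dphi (x : R) : is_derive x 1 phi (derive1 phi1 x - derive1 phi2 x).
  rewrite -mulN1r.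
  exact: (@is_deriveD _ _ _ phi1 (fun y : R => -1 * phi2 y) x 1 _ _ (d1 x)
    (@is_deriveZ _ _ _ phi2 (-1) x 1 _ (d2 x))).
have phi'E (x : R) : derive1 phi x = derive1 phi1 x - derive1 phi2 x.
  by rewrite derive1E; have [_ ->] := dphi x.
(* [Q'] dominates [f * phi' + c * phi]: this function is [W * phi'] plus the derivative of
   [c * x * phi], and [W] is at most [c1] where [phi1] varies and at least [c2] where [phi2] varies.
   Since [phi] vanishes at both ends, [Q'] integrates to [c1 - c2]. *)
pose Q (x : R) := c1 * phi1 x - c2 * phi2 x + c * (x * phi x).
pose Q' (x : R) := c1 * derive1 phi1 x - c2 * derive1 phi2 x + c * (phi x + x * derive1 phi x).
have dQ (x : R) : is_derive x 1 Q (Q' x).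
  have dxphi := @is_deriveM _ _ id phi x 1 _ _ (is_derive_id x 1) (dphi x).
  have := @is_deriveD _ _ _ _ (fun y : R => c * (y * phi y)) x 1 _ _
    (@is_deriveB _ _ _ (fun y : R => c1 * phi1 y) (fun y : R => c2 * phi2 y) x 1 _ _
      (@is_deriveZ _ _ _ phi1 c1 x 1 _ (d1 x))
      (@is_deriveZ _ _ _ phi2 c2 x 1 _ (d2 x)))
    (@is_deriveZ _ _ _ _ c x 1 _ dxphi).
  have scE (a b : R) : a *: (b : R^o) = a * b by [].
  by move/is_derive_eq; apply; rewrite /Q' phi'E !scE mulr1 [phi x + _]addrC.
have cphi := smooth_continuous sphi.
have cphi' := smooth_continuous (smooth_derive1 sphi).
have cphi1' := smooth_continuous (smooth_derive1 (smooth_ramp (s + d) d)).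
have cphi2' := smooth_continuous (smooth_derive1 (smooth_ramp (t - 2 * d) d)).
have cQ' : continuous Q'.
  move=> x; apply: cvgD; first by apply: cvgB;
    (apply: cvgM; [exact: cvg_cst|]); [exact: cphi1'|exact: cphi2'].
  apply: cvgM; [exact: cvg_cst|]; apply: cvgD; first exact: cphi.
  by apply: cvgM; [exact: cvg_id|exact: cphi'].
have cQ : continuous Q.
  by move=> x; have [/derivable1_diffP /differentiable_continuous] := dQ x.
have ioo g : {within `[s, t], continuous g} -> mu.-integrable `]s, t[ (EFin \o g).
  move=> cg; apply: (@integrableS _ _ _ mu `[s, t]%classic) => //.
    exact: subset_itv_oo_cc.
  apply: continuous_compact_integrable => //; exact: segment_compact.
have iQ' : \int[mu]_(x in `]s, t[) Q' x = c1 - c2.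
  rewrite Rintegral_itv_obnd_cbnd; last first.
    exact/ioo/continuous_subspaceT.
  rewrite Rintegral_itv_bndo_bndc; last first.
    apply: (@integrableS _ _ _ mu `[s, t]%classic) => //; first exact: subset_itv_co_cc.
    apply: continuous_compact_integrable; first exact: segment_compact.
    exact: continuous_subspaceT.
  rewrite /Rintegral (continuous_FTC2 (F := Q) st); first last.
  - by move=> x _; rewrite derive1E; have [_ ->] := dQ x.
  - split; first by move=> x _; have [] := dQ x.
      by apply: cvg_at_right_filter; exact: cQ.
    by apply: cvg_at_left_filter; exact: cQ.
  - exact: continuous_subspaceT.
  rewrite /= /Q !phi0 ?mulr0 ?addr0; [|by left; lra|by right; lra].
  have [-> ->] : phi1 t = 1 /\ phi2 t = 1 by split; apply: ramp_eq1 => //; lra.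
  have [-> ->] : phi1 s = 0 /\ phi2 s = 0 by split; apply: ramp_eq0 => //; lra.
  by rewrite !mulr0 !mulr1 subrr subr0.
have ifphi : mu.-integrable `]s, t[ (EFin \o (fun x => f x * derive1 phi x)).
  apply: ioo => x; apply: cvgM; first exact: cf.
  by have /continuous_subspaceT := cphi'; apply.
have icphi : mu.-integrable `]s, t[ (EFin \o (fun x => c * phi x)).
  apply: ioo; apply: continuous_subspaceT => x; apply: cvgM; [exact: cvg_cst|]; exact: cphi.
have ipphi := integrable_test_function lip tphi.
have le1 : \int[mu]_(x in `]s, t[) (p x * phi x) <= \int[mu]_(x in `]s, t[) (c * phi x).
  apply: ae_le_Rintegral => //.
  apply: (@filterS _ _ (ae_filter_ringOfSetsType mu) _ _ _ pc) => x pcx xst.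
  by rewrite ler_wpM2r// pcx.
have le2 : \int[mu]_(x in `]s, t[) (f x * derive1 phi x + c * phi x) <=
    \int[mu]_(x in `]s, t[) Q' x.
  apply: le_Rintegral => //.
  - exact: (integrableD _ ifphi icphi).
  - by apply: ioo; apply: continuous_subspaceT.
  move=> x /=; rewrite in_itv/= => /andP[sx xt].
  have h1 : W x * derive1 phi1 x <= c1 * derive1 phi1 x.
    have [xd|xd] := leP x (s + 2 * d).
      by rewrite ler_wpM2r ?ramp_derive1_ge0// dW1// sx.
    by rewrite ramp_derive1_eq0 ?mulr0//; right; lra.
  have h2 : c2 * derive1 phi2 x <= W x * derive1 phi2 x.
    have [xd|xd] := leP (t - 2 * d) x.
      by rewrite ler_wpM2r ?ramp_derive1_ge0// dW2// xt xd.
    by rewrite ramp_derive1_eq0 ?mulr0//; left.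
  move: h1 h2; rewrite /Q' phi'E /W.
  move: (derive1 phi1 x) (derive1 phi2 x) (phi x) (f x) => a b z y; lra.
(* The weak derivative identity turns the left side of [le2] into the integral of [(c - p) * phi],
   nonnegative by [le1], whereas [c1 - c2 < 0]. *)
move: le2; rewrite RintegralD// weak// iQ'; lra.
Qed.

(** The upper bound applied to [- f], whose weak derivative is [- p]. *)
Lemma weak_derivative_ge (f p : R -> R) (s t c : R) : s < t ->
  {within `[s, t], continuous f} ->
  locally_integrable `]s, t[ p ->
  (forall phi, test_function s t phi ->
    \int[mu]_(x in `]s, t[) (f x * derive1 phi x) =
    - \int[mu]_(x in `]s, t[) (p x * phi x)) ->
  {ae mu, forall x, x \in `]s, t[ -> c <= p x} ->
  c * (t - s) <= f t - f s.
Proof.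
move=> st cf lip weak pc.
suff : - f t - - f s <= - c * (t - s) by lra.
apply: (@weak_derivative_le (fun x => - f x) (fun x => - p x)) => //.
- by move=> x; apply: cvgN; exact: cf.
- case: lip => mp oD ip; split => //; first exact: measurableT_comp.
  move=> K KD cK; have := ip K KD cK.
  by under [X in _ -> (X < _)%E]eq_integral do rewrite normrN.
- move=> phi tphi.
  have ip := integrable_test_function lip tphi.
  have ifphi : mu.-integrable `]s, t[ (EFin \o (fun x => f x * derive1 phi x)).
    apply: (@integrableS _ _ _ mu `[s, t]%classic) => //; first exact: subset_itv_oo_cc.
    apply: continuous_compact_integrable; first exact: segment_compact.
    move=> x; apply: cvgM; first exact: cf.
    have cphi' : continuous (derive1 phi).
      move=> y; apply: differentiable_continuous.
      by case: tphi => /(_ 1%N y) /derivable1_diffP.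
    by have /continuous_subspaceT := cphi'; apply.
  under eq_Rintegral do rewrite mulNr -mulN1r.
  rewrite RintegralZl// weak// mulN1r.
  under [in RHS]eq_Rintegral do rewrite mulNr -mulN1r.
  by rewrite RintegralZl// mulN1r.
- apply: (@filterS _ _ (ae_filter_ringOfSetsType mu) _ _ _ pc) => x pcx xst.
  by rewrite lerN2 pcx.
Qed.

End weak_derivative.

(** * Growth of a continuous function held by an obstacle *)

Section obstacle.
Context {R : realType}.

(* Apply the slope bound after the last time at which [f] vanishes. *)
Lemma lower_obstacle_slope_le (f : R -> R) (a b c : R) : a <= b ->
  {within `[a, b], continuous f} -> 0 <= f a ->
  (forall s t, a <= s -> s < t -> t <= b ->
    (forall x, s < x < t -> 0 < f x) -> f t - f s <= c * (t - s)) ->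
  f b <= Num.max 0 (f a + c * (b - a)).
Proof.
rewrite le_eqVlt => /predU1P[->|ab] cf fa slope.
  by rewrite subrr mulr0 addr0 le_max lexx orbT.
rewrite le_max; have [//|fb /=] := leP (f b) 0.
pose Z := [set x | a <= x <= b /\ f x <= 0].
have [[z0 Zz0]|Z0] := pselect (Z !=set0); last first.
  rewrite addrC -lerBlDr; apply: slope => // x /andP[ax xb].
  rewrite ltNge; apply/negP => fx; apply: Z0; exists x.
  by split => //; rewrite !ltW.
have supZ : has_sup Z.
  by split; [exists z0|exists b => x [/andP[]]].
pose s := sup Z.
have as_ : a <= s by apply: le_trans (ub_le_sup supZ.2 Zz0); case: Zz0 => /andP[].
have sb : s <= b by apply: ge_sup; [exists z0|move=> x [/andP[]]].
(* Otherwise [f] would be positive near [s] by continuity, although points of [Z] lie arbitrarily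
   close to its supremum. *)
have fs : f s <= 0.
  rewrite leNgt; apply/negP => fs.
  have /subspace_continuousP /(_ s) := cf.
  rewrite /= in_itv/= as_ sb => /(_ isT) cfs.
  have [e /= e0 He] : \forall x \near within `[a, b] (nbhs s), 0 < f x.
    exact: cvgr_gt cfs _ fs.
  have [z Zz sz] := sup_adherent e0 supZ.
  have zs := ub_le_sup supZ.2 Zz; case: Zz => zab.
  rewrite leNgt => /negP; apply; apply: He => /=.
    by rewrite ger0_norm ?subr_ge0//; rewrite -/s in sz zs *; lra.
  by rewrite in_itv.
have {sb} sb : s < b by rewrite lt_neqAle sb andbT; apply/eqP => sbE; move: fs; rewrite sbE; lra.
have := slope s b as_ sb (lexx b).
have pos x : s < x < b -> 0 < f x.
  move=> /andP[sx xb]; rewrite ltNge; apply/negP => fx.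
  have : x <= s; last by lra.
  apply: (ub_le_sup supZ.2); split => //.
  by apply/andP; split; lra.
move=> /(_ pos) fbs.
(* For [c > 0] the slope over the shorter interval is enlarged to [c * (b - a)], and
   [f s <= 0 <= f a]. For [c <= 0] the slope bound gives [f b <= f s <= 0], against [0 < f b]. *)
have [c0|c0] := ltP 0 c.
  have : c * (b - s) <= c * (b - a) by rewrite ler_pM2l//; lra.
  by lra.
have : c * (b - s) <= 0 by rewrite mulr_le0_ge0//; lra.
by lra.
Qed.

(** The reflection [d - f] turns the upper obstacle [d] into the lower obstacle 0 and the slope [c]
    into [- c]. *)
Lemma upper_obstacle_slope_ge (f : R -> R) (a b c d : R) : a <= b ->
  {within `[a, b], continuous f} -> f a <= d ->
  (forall s t, a <= s -> s < t -> t <= b ->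
    (forall x, s < x < t -> f x < d) -> c * (t - s) <= f t - f s) ->
  Num.min d (f a + c * (b - a)) <= f b.
Proof.
move=> ab cf fa slope.
have : d - f b <= Num.max 0 (d - f a + - c * (b - a)).
  apply: (@lower_obstacle_slope_le (fun x => d - f x)) => //.
  - by move=> x; apply: cvgB; [exact: cvg_cst|exact: cf].
  - by rewrite subr_ge0.
  - move=> s t sa st tb pos.
    suff : c * (t - s) <= f t - f s by lra.
    by apply: slope => // x /pos; rewrite subr_gt0.
rewrite le_max ge_min => /orP[h|h]; apply/orP; [left|right]; lra.
Qed.

End obstacle.

(** * Maximum-norm estimates and the second-order expansion of the matrix exponential *)

Section matrix_estimates.
Context {R : realType}.

Lemma mx_entry_le_norm m n (A : 'M[R]_(m, n)) i j : `|A i j| <= `|A|.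
Proof.
rewrite [leRHS]/Num.norm/= mx_normrE.
by apply: (@le_bigmax _ _ _ 0 (fun ij : 'I_m * 'I_n => `|A ij.1 ij.2|) (i, j)).
Qed.

Lemma mx_norm_le m n (A : 'M[R]_(m, n)) (c : R) : 0 <= c ->
  (forall i j, `|A i j| <= c) -> `|A| <= c.
Proof.
move=> c0 Ac; rewrite [leLHS]/Num.norm/= mx_normrE.
by apply/bigmax_leP; split => // -[i j] _; exact: Ac.
Qed.

(** The norm is the largest absolute value of an entry, so the factor [n] counts the summands in an
    entry of the product. *)
Lemma mx_norm_mulmx m n p (A : 'M[R]_(m, n)) (B : 'M[R]_(n, p)) :
  `|A *m B| <= n%:R * `|A| * `|B|.
Proof.
apply: mx_norm_le => [|i j]; first by rewrite !mulr_ge0.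
rewrite mxE; apply: le_trans (ler_norm_sum _ _ _) _.
apply: (@le_trans _ _ (\sum_(k < n) `|A| * `|B|)).
  by apply: ler_sum => k _; rewrite normrM ler_pM// mx_entry_le_norm.
by rewrite sumr_const card_ord -[leLHS]mulr_natl mulrA.
Qed.

Lemma mx_norm_expr n (F : 'M[R]_n.+1) k : `|F ^+ k| <= (n.+1%:R * `|F|) ^+ k.
Proof.
elim: k => [|k IH].
  apply: mx_norm_le => // i j; rewrite !expr0 mxE.
  by case: eqP => _; rewrite ?normr1 ?normr0.
rewrite exprS; apply: le_trans (mx_norm_mulmx _ _) _.
by rewrite [leRHS]exprS ler_wpM2l// mulr_ge0.
Qed.

(** Dropping the factorial leaves a geometric majorant, summable for small [F]; small time steps are
    all that the expansion below serves. *)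
Lemma expmx_term_le n (F : 'M[R]_n.+1) k :
  `|(k`!%:R)^-1 *: F ^+ k| <= (n.+1%:R * `|F|) ^+ k.
Proof.
rewrite normrZ; apply: le_trans (mx_norm_expr F k).
rewrite ler_piMl// ger0_norm ?invr_ge0// invf_le1 ?ltr0n ?fact_gt0//.
by rewrite ler1n fact_gt0.
Qed.

Lemma is_cvg_expmx n (F : 'M[R]_n.+1) : n.+1%:R * `|F| < 1 ->
  cvgn (series (fun k => (k`!%:R)^-1 *: F ^+ k)).
Proof.
move=> F1; apply: (@normed_cvg R (HB.pack_for (completeNormedModType R) 'M[R]_n.+1)).
apply: (@series_le_cvg _ _ (geometric 1 (n.+1%:R * `|F|))) => //.
- by move=> k; exact: normr_ge0.
- by move=> k; rewrite /= mul1r exprn_ge0// mulr_ge0.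
- by move=> k; rewrite /= mul1r expmx_term_le.
- by apply: is_cvg_geometric_series; rewrite ger0_norm// mulr_ge0.
Qed.

(** With [x := n.+1%:R * |F|], the terms from index 2 on sum to at most [x ^+ 2 / (1 - x)], and
    [x <= 1/2] bounds [1 / (1 - x)] by 2. *)
Lemma expmx_second_order n (F : 'M[R]_n.+1) : n.+1%:R * `|F| <= 2^-1 ->
  `|expmx F - (1%:M + F)| <= 2 * (n.+1%:R * `|F|) ^+ 2.
Proof.
set x := n.+1%:R * `|F| => x2.
have x0 : 0 <= x by rewrite mulr_ge0.
have x1 : x < 1 by lra.
have /cvg_norm : (fun k => series (fun k => (k`!%:R)^-1 *: F ^+ k) k - (1%:M + F)) @ \oo
    --> expmx F - (1%:M + F).
  by apply: cvgB; [exact: is_cvg_expmx|exact: cvg_cst].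
move/cvgr_to_le; apply; exists 2%N => // k /= k2.
rewrite seriesEnat /= (big_cat_nat _ k2)//= big_nat_recr//= big_nat1.
rewrite fact0 factS fact0 invr1 !scale1r expr0 expr1.
rewrite idmxE [1 + F + _]addrC addrK.
apply: le_trans (ler_norm_sum _ _ _) _.
apply: (@le_trans _ _ (\sum_(2 <= i < k) x ^+ i)).
  by apply: ler_sum_nat => i _; exact: expmx_term_le.
rewrite -(subnKC k2) geometric_partial_tail.
have [x_gt0|x_le0] := ltP 0 x; last first.
  have -> : x = 0 by apply/eqP; rewrite eq_le x_le0.
  by rewrite expr2 mulr0 mulr0 /series/= big1// => i _; rewrite mul0r.
apply: le_trans (geometric_le_lim _ _ x_gt0 _) _; rewrite ?sqr_ge0//.
  by rewrite ger0_norm.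
rewrite mulrC ler_wpM2r ?sqr_ge0//.
by rewrite -[leRHS]invrK lef_pV2 ?posrE; lra.
Qed.

End matrix_estimates.

(** * Invertibility of the operator [A] *)

Section operator.
Context {R : realType} {n : nat}.
Variables (w : 'M[R]_n.+1) (r : R) (mu : 'cV[R]_n.+1).
Hypotheses (n2 : (2 <= n.+1)%N) (gw : weighted_connected_graph w).
Hypotheses (mu_ge0 : valued_in `[0, +oo[ mu) (mu_neq0 : mu != 0).

(** A path from [i] to some other vertex begins with an edge of positive weight at [i]. *)
Lemma degree_gt0 i : 0 < degree w i.
Proof.
have [w_ge0 wC w0 conn] := gw.
have [j ij] : exists j, j != i.
  exists (if i == ord0 then ord_max else ord0); case: (eqVneq i ord0) => [->|].
    by rewrite -val_eqE /= -lt0n.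
  by rewrite eq_sym.
have /connectP [[|k p] /= pth jE] := conn i j; first by rewrite jE eqxx in ij.
case/andP: pth => wik _.
by rewrite /degree (bigD1 k)//= ltr_pwDl// sumr_ge0.
Qed.

Lemma opA_mulmx_entry (u : 'cV[R]_n.+1) i :
  (opA w r mu *m u) i 0 =
  degree w i `^ (- r) * \sum_j w i j * (u i 0 - u j 0) + mu i 0 * u i 0.
Proof.
rewrite mulmxDl mxE laplacian_mulmx mxE; congr (_ + _).
by rewrite /fidelity_mx mul_diag_mx !mxE.
Qed.

(** Exchanging the summation indices replaces the factor [u i 0] by [- u j 0]; averaging both forms
    produces the square. *)
Lemma dirichlet_form (u : 'cV[R]_n.+1) : (forall i j, w i j = w j i) ->
  \sum_i u i 0 * \sum_j w i j * (u i 0 - u j 0) =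
  2^-1 * \sum_i \sum_j w i j * (u i 0 - u j 0) ^+ 2.
Proof.
move=> wC; pose S := \sum_i \sum_j u i 0 * (w i j * (u i 0 - u j 0)).
have S' : S = \sum_i \sum_j - (u j 0 * (w i j * (u i 0 - u j 0))).
  rewrite /S exchange_big /=; apply: eq_bigr => i _; apply: eq_bigr => j _.
  by rewrite wC; ring.
have -> : \sum_i u i 0 * \sum_j w i j * (u i 0 - u j 0) = S.
  by apply: eq_bigr => i _; rewrite mulr_sumr.
have -> : S = 2^-1 * (S + S) by move: S {S'} => S; field.
congr (_ * _); rewrite {2}S' -big_split; apply: eq_bigr => i _ /=.
by rewrite -big_split; apply: eq_bigr => j _ /=; ring.
Qed.

(** Pairing [A u] with [u] in the weighted inner product gives a Dirichlet energy plus a fidelity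
    energy, both nonnegative and hence zero. The first makes [u] constant along edges, so constant
    by connectedness; the second makes it vanish at a vertex where [mu] does not. *)
Lemma opA_ker (u : 'cV[R]_n.+1) : opA w r mu *m u = 0 -> u = 0.
Proof.
move=> Au; have [w_ge0 wC w0 conn] := gw.
have dr i : 0 < degree w i `^ r by rewrite powR_gt0// degree_gt0.
have mu0 i : 0 <= mu i 0 by have := mu_ge0 i; rewrite /= in_itv/= andbT.
have Aui i : degree w i `^ r * (u i 0 * (opA w r mu *m u) i 0) =
    u i 0 * (\sum_j w i j * (u i 0 - u j 0)) +
    degree w i `^ r * (mu i 0 * u i 0 ^+ 2).
  rewrite opA_mulmx_entry powRN; field; rewrite gt_eqF//; exact: dr.
have S0 : 2^-1 * (\sum_i \sum_j w i j * (u i 0 - u j 0) ^+ 2) +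
    \sum_i degree w i `^ r * (mu i 0 * u i 0 ^+ 2) = 0.
  rewrite -dirichlet_form// -big_split /=.
  by apply: big1 => i _; rewrite -Aui Au mxE !mulr0.
have T1 i j : 0 <= w i j * (u i 0 - u j 0) ^+ 2 by rewrite mulr_ge0 ?sqr_ge0.
have T2 i : 0 <= degree w i `^ r * (mu i 0 * u i 0 ^+ 2).
  by rewrite mulr_ge0 ?powR_ge0// mulr_ge0 ?sqr_ge0.
have P1 : 0 <= \sum_i \sum_j w i j * (u i 0 - u j 0) ^+ 2.
  by apply: sumr_ge0 => i _; apply: sumr_ge0 => j _.
have P2 : 0 <= \sum_i degree w i `^ r * (mu i 0 * u i 0 ^+ 2).
  exact: sumr_ge0.
have Z1 : \sum_i \sum_j w i j * (u i 0 - u j 0) ^+ 2 = 0 by lra.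
have Z2 : \sum_i degree w i `^ r * (mu i 0 * u i 0 ^+ 2) = 0 by lra.
have edge i j : 0 < w i j -> u i 0 = u j 0.
  move=> wij; have /psumr_eq0P : \sum_j w i j * (u i 0 - u j 0) ^+ 2 = 0.
    move/psumr_eq0P: Z1; apply => // k _; exact: sumr_ge0.
  move=> /(_ (fun j _ => T1 i j) j isT) /eqP.
  by rewrite mulf_eq0 gt_eqF//= sqrf_eq0 subr_eq0 => /eqP.
have const i j : u i 0 = u j 0.
  have /connectP [p pth ->] := conn i j.
  by elim: p i pth => //= k p IH i /andP[/edge -> /IH].
have [i mui] : exists i, mu i 0 != 0.
  apply: contrapT => h; move/negP: mu_neq0; apply; apply/eqP/matrixP => i j.
  by rewrite ord1 mxE; apply: contrapT => /eqP mi; apply: h; exists i.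
have ui : u i 0 = 0.
  move/psumr_eq0P: Z2 => /(_ (fun j _ => T2 j) i isT) /eqP.
  by rewrite mulf_eq0 gt_eqF//= mulf_eq0 (negPf mui)/= sqrf_eq0 => /eqP.
by apply/matrixP => k l; rewrite ord1 mxE (const k i).
Qed.

(** [kermx] is a kernel of row vectors, so the triviality of the column kernel is applied through
    the transpose. *)
Lemma opA_unitmx : opA w r mu \in unitmx.
Proof.
rewrite -unitmx_tr -row_free_unit -kermx_eq0; apply/eqP/row_matrixP => i.
rewrite row0; apply: trmx_inj; rewrite trmx0; apply: opA_ker.
have rowA : row i (kermx (opA w r mu)^T) *m (opA w r mu)^T = 0.
  exact/sub_kermxP/row_sub.
by rewrite -[X in X *m _]trmxK -trmx_mul rowA trmx0.
Qed.

End operator.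

(** * The drift field and one step of the SDIE scheme *)

Section drift.
Context {R : realType} {n : nat}.
Implicit Types (A : 'M[R]_n.+1) (f u v : 'cV[R]_n.+1) (eps : R).

Definition drift A f eps u : 'cV[R]_n.+1 :=
  f - A *m u + eps^-1 *: (u - const_mx 2^-1).

Lemma driftE A f eps u i :
  drift A f eps u i 0 = f i 0 - (A *m u) i 0 + eps^-1 * (u i 0 - 2^-1).
Proof. by rewrite /drift; move: (A *m u) => Au; rewrite !mxE. Qed.

Lemma valued_in01_norm u : valued_in `[0, 1] u -> `|u| <= 1.
Proof.
move=> u01; apply: mx_norm_le => // i j; rewrite ord1.
by have := u01 i; rewrite /= in_itv/= => /andP[u0 u1]; rewrite ger0_norm.
Qed.

Lemma drift_lipschitz A f eps : 0 < eps -> exists2 L : R, 0 <= L &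
  forall u v, `|drift A f eps u - drift A f eps v| <= L * `|u - v|.
Proof.
move=> e0; exists (n.+1%:R * `|A| + eps^-1).
  by rewrite addr_ge0 ?mulr_ge0// invr_ge0 ltW.
move=> u v.
have -> : drift A f eps u - drift A f eps v = eps^-1 *: (u - v) - A *m (u - v).
  rewrite /drift mulmxBr; apply/matrixP => i j; rewrite ord1.
  by move: (A *m u) (A *m v) => Au Av; rewrite !mxE; ring.
apply: le_trans (ler_normB _ _) _; rewrite mulrDl addrC lerD ?mx_norm_mulmx//.
by rewrite normrZ gtr0_norm// invr_gt0.
Qed.

Lemma drift_bounded A f eps : 0 < eps -> exists2 K : R, 0 <= K &
  forall u, valued_in `[0, 1] u -> `|drift A f eps u| <= K.
Proof.
move=> e0; have [L L0 lip] := drift_lipschitz A f e0.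
exists (`|drift A f eps 0| + L); first by rewrite addr_ge0.
move=> u u01; rewrite -[drift A f eps u](subrK (drift A f eps 0)).
apply: le_trans (ler_normD _ _) _; rewrite addrC lerD2l.
apply: le_trans (lip _ _) _; rewrite subr0 ler_piMr//.
exact: valued_in01_norm.
Qed.

(** Writing [exp(-tA) = I - tA + Q], the inverse of [A] cancels in the forcing term and the
    remainder is exactly [Q u - A^-1 Q f], with [Q] of order [t ^+ 2]. *)
Lemma fidelity_diffusion_second_order A f : A \in unitmx ->
  exists tC : R * R, [/\ 0 < tC.1, 0 <= tC.2 &
    forall t u, 0 <= t <= tC.1 -> valued_in `[0, 1] u ->
    `|fidelity_diffusion A f t u - (u + t *: (f - A *m u))| <= tC.2 * t ^+ 2].
Proof.
move=> uA; pose N : R := n.+1%:R; pose a := N * `|A|.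
have N0 : 0 <= N by [].
have a0 : 0 <= a by rewrite mulr_ge0.
(* The threshold forces [t * a <= 1/2], as the expansion of the exponential demands; [a + 1] keeps
   it meaningful when [a = 0]. *)
exists ((2 * (a + 1))^-1,
  (N * (2 * a ^+ 2) + N * (N * `|invmx A| * (2 * a ^+ 2)) * `|f|)).
split => /=.
- by rewrite invr_gt0 mulr_gt0// ltr_wpDl.
- by rewrite addr_ge0 ?mulr_ge0 ?sqr_ge0.
move=> t u /andP[t0 t1] u01.
have Fnorm : N * `|- t *: A| = t * a.
  by rewrite normrZ normrN ger0_norm// /a mulrCA.
have ta : t * a <= 2^-1.
  apply: (@le_trans _ _ (t * (a + 1))); first by rewrite ler_wpM2l// lerDl.
  rewrite -ler_pdivlMr ?ltr_wpDl//; apply: le_trans t1 _.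
  by rewrite invfM.
have := @expmx_second_order R n (- t *: A).
rewrite -/N Fnorm => /(_ ta).
set E := expmx _; set Q := E - _ => Qle.
have EE : E = 1%:M - t *: A + Q by rewrite /Q scaleNr addrC subrK.
clearbody Q.
have -> : fidelity_diffusion A f t u - (u + t *: (f - A *m u)) =
    Q *m u - invmx A *m Q *m f.
  rewrite /fidelity_diffusion -/E EE.
  have -> : 1%:M - (1%:M - t *: A + Q) = t *: A - Q.
    by rewrite opprD opprB addrA addrCA subrr addr0.
  rewrite mulmxBr -scalemxAr mulVmx// !mulmxBl !mulmxDl mulNmx mul1mx.
  rewrite -!scalemxAl mul1mx scalerBr.
  move: (Q *m u) (invmx A *m Q *m f) (t *: (A *m u)) (t *: f) => q1 q2 q3 q4.
  by apply/matrixP => i j; rewrite !mxE; ring.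
have {Qle} Qle : `|Q| <= 2 * a ^+ 2 * t ^+ 2.
  by apply: le_trans Qle _; rewrite exprMn; lra.
have t20 : 0 <= t ^+ 2 by rewrite sqr_ge0.
apply: le_trans (ler_normB _ _) _; rewrite mulrDl lerD//.
  apply: le_trans (mx_norm_mulmx _ _) _; rewrite -/N.
  apply: (@le_trans _ _ (N * `|Q|)).
    by rewrite ler_piMr ?mulr_ge0// valued_in01_norm.
  by rewrite -mulrA ler_wpM2l.
apply: le_trans (mx_norm_mulmx _ _) _; rewrite -/N [leRHS]mulrAC.
rewrite ler_wpM2r// -[leRHS]mulrA ler_wpM2l//.
apply: le_trans (mx_norm_mulmx _ _) _; rewrite -/N -[leRHS]mulrA.
by apply: ler_wpM2l => //; rewrite mulr_ge0.
Qed.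

(* Below the upper obstacle the multiplier is nonnegative, above the lower one
   it is nonpositive, so that the implicit step is a truncated Euler step. *)
Lemma SDIE_step A f eps : 0 < eps -> A \in unitmx ->
  exists tC : R * R, [/\ 0 < tC.1, 0 <= tC.2 &
    forall tau u v beta, 0 < tau <= tC.1 -> valued_in `[0, 1] u ->
    (1 - tau / eps) *: v - fidelity_diffusion A f tau u
      + (tau / eps / 2) *: const_mx 1 = (tau / eps) *: beta ->
    subdiffB v beta ->
    forall i,
    (v i 0 = 1 \/ u i 0 + tau * drift A f eps u i 0 - tC.2 * tau ^+ 2 <= v i 0) /\
    (v i 0 = 0 \/ v i 0 <= u i 0 + tau * drift A f eps u i 0 + tC.2 * tau ^+ 2)].
Proof.
move=> e0 uA.
have [[t1 C1] /= [t10 C10 Sle]] := fidelity_diffusion_second_order f uA.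
have [K K0 Kb] := drift_bounded A f e0.
(* The bound [eps / 2] gives [1 - tau / eps >= 1/2], so dividing by this factor costs the 2 in the
   constant. *)
exists (Num.min t1 (eps / 2), 2 * (C1 + K / eps)); split => /=.
- by rewrite lt_min t10 divr_gt0.
- by rewrite mulr_ge0// addr_ge0// divr_ge0// ltW.
move=> tau u v beta /andP[tau0]; rewrite le_min => /andP[taut1 taue] u01 Ev.
move=> [v01 vbeta] i.
have [b0 bi b1] := vbeta i.
have := v01 i; rewrite /= in_itv/= => /andP[v0 v1].
set l := tau / eps in Ev *.
have l0 : 0 < l by rewrite divr_gt0.
have l2 : l <= 2^-1 by rewrite ler_pdivrMr// mulrC.
have := le_trans (mx_entry_le_norm _ i 0) (Sle tau u _ u01).
rewrite (ltW tau0) taut1 => /(_ isT).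
have : (1 - l) * v i 0 - fidelity_diffusion A f tau u i 0 + l / 2 = l * beta i 0.
  move/matrixP: Ev => /(_ i 0).
  by move: (fidelity_diffusion _ _ _ _) => S; rewrite !mxE mulr1.
have := le_trans (mx_entry_le_norm _ i 0) (Kb u u01).
have DE : tau * drift A f eps u i 0 =
    tau * (f i 0 - (A *m u) i 0) + l * (u i 0 - 2^-1).
  by rewrite driftE /l; ring.
have SE : (fidelity_diffusion A f tau u - (u + tau *: (f - A *m u))) i 0 =
  fidelity_diffusion A f tau u i 0 - (u i 0 + tau * (f i 0 - (A *m u) i 0)).
  by move: (fidelity_diffusion _ _ _ _) (A *m u) => S Au; rewrite !mxE.
rewrite SE.
move: DE; move: (drift A f eps u i 0) (fidelity_diffusion A f tau u i 0) => D S.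
move: (tau * (f i 0 - (A *m u) i 0)) => q DE Kbi ES.
rewrite ler_norml => /andP[S1 S2].
have lE : l * K * tau = K / eps * tau ^+ 2 by rewrite /l; ring.
move: Kbi; rewrite ler_norml => /andP[K1 K2].
have lt0 : 0 < l * tau by rewrite mulr_gt0.
have lD1 : l * tau * D <= l * tau * K by rewrite ler_pM2l.
have lD2 : - (l * tau * K) <= l * tau * D by rewrite -mulrN ler_pM2l.
have m0 : 0 < 1 - l by lra.
(* By [DE], [(1 - l)] times the Euler value [u + tau * D] is [u + q - l / 2 - l * tau * D]. Compared
   with [S - l / 2], the error thus consists of the diffusion remainder and of [l * tau * D]. *)
have C2 : C1 * tau ^+ 2 + l * tau * K <=
    (1 - l) * (2 * (C1 + K / eps) * tau ^+ 2).
  rewrite (_ : l * tau * K = K / eps * tau ^+ 2); last by rewrite -lE; ring.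
  have P0 : 0 <= (C1 + K / eps) * tau ^+ 2.
    by rewrite mulr_ge0 ?sqr_ge0// addr_ge0// divr_ge0// ltW.
  have P1 := ler_wpM2r P0 (_ : 1 <= (1 - l) * 2).
  by have := P1 ltac:(lra); lra.
split.
- have [->|vn1] := eqVneq (v i 0) 1; [by left|right].
  have be : 0 <= l * beta i 0.
    apply: mulr_ge0; first exact: ltW.
    have [vz|vz] := eqVneq (v i 0) 0; first exact: b0.
    by rewrite bi// !lt_neqAle eq_sym vz v0 vn1 v1.
  by rewrite -(ler_pM2l m0); lra.
- have [->|vn0] := eqVneq (v i 0) 0; [by left|right].
  have be : l * beta i 0 <= 0.
    apply: mulr_ge0_le0; first exact: ltW.
    have [vz|vz] := eqVneq (v i 0) 1; first exact: b1.
    by rewrite bi// !lt_neqAle eq_sym vn0 v0 vz v1.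
  by rewrite -(ler_pM2l m0); lra.
Qed.

End drift.

(** * One time step of the Allen-Cahn solution *)

Section ACE.
Context {R : realType} {n : nat}.
Variables (w : 'M[R]_n.+1) (r : R) (mu f : 'cV[R]_n.+1) (eps : R).
Variables (u beta : R -> 'cV[R]_n.+1).
Hypotheses (eps_gt0 : 0 < eps).
Hypothesis (uACE : ACE_solution w r mu f eps `[0, +oo[ u beta).
Let D := drift (opA w r mu) f eps.

Lemma ACE_valued_in t : 0 <= t -> valued_in `[0, 1] (u t).
Proof. by move=> t0; case: uACE => + _ _ _; apply; rewrite in_itv/= t0. Qed.

Lemma ACE_continuous i s t : 0 <= s ->
  {within `[s, t], continuous (fun x => u x i 0)}.
Proof.
move=> s0; case: uACE => _ _ cu _.
have cst : {within `[s, t], continuous u}.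
  apply: continuous_subspaceW cu => x /=; rewrite !in_itv/= => /andP[sx _].
  by rewrite andbT (le_trans s0).
move=> x; exact: (cvg_comp _ _ (cst x) (@coord_continuous _ _ _ i 0 (u x))).
Qed.

(** The equation says that [du - D u] is [beta / eps], and [beta] is nonpositive off the lower
    obstacle and nonnegative off the upper one. *)
Lemma ACE_derivative : exists2 du : R -> 'cV[R]_n.+1,
  forall s t, 0 <= s -> 0 <= t -> weak_derivative s t u du &
  {ae lebesgue_measure, forall x, 0 <= x -> forall i,
    (0 < u x i 0 -> du x i 0 <= D (u x) i 0) /\
    (u x i 0 < 1 -> D (u x) i 0 <= du x i 0)}.
Proof.
case: uACE => _ _ _ [du wdu aedu]; exists du.
  by move=> s t s0 t0; apply: wdu; rewrite in_itv/= andbT.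
apply: (@filterS _ _ (ae_filter_ringOfSetsType lebesgue_measure) _ _ _ aedu) => x.
rewrite in_itv/= andbT => + x0 i => /(_ x0)[/matrixP /(_ i 0) E [u01 /(_ i)[b0 bi b1]]].
have {E} E : eps * (du x i 0 - D (u x) i 0) = beta x i 0.
  rewrite -E /D driftE; move: (opA w r mu *m u x) => Au; rewrite !mxE.
  by field; rewrite gt_eqF.
have := u01 i; rewrite /= in_itv/= => /andP[v0 v1].
split=> h.
- rewrite -subr_le0 -(pmulr_rle0 _ eps_gt0) E.
  have [vz|vz] := eqVneq (u x i 0) 1; first exact: b1.
  by rewrite bi// h lt_neqAle vz.
- rewrite -subr_ge0 -(pmulr_rge0 _ eps_gt0) E.
  have [vz|vz] := eqVneq (u x i 0) 0; first exact: b0.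
  by rewrite bi// h lt_neqAle eq_sym vz v0.
Qed.

(** While the component is positive its weak derivative is at most [c] almost everywhere;
    [weak_derivative_le] converts this into the slope hypothesis of the obstacle lemma. *)
Lemma ACE_le i s t c : 0 <= s -> s <= t ->
  (forall x, s <= x <= t -> D (u x) i 0 <= c) ->
  u t i 0 <= Num.max 0 (u s i 0 + c * (t - s)).
Proof.
move=> s0 st Dc; have [du wdu aedu] := ACE_derivative.
apply: (@lower_obstacle_slope_le _ (fun x => u x i 0)) => //.
- exact: ACE_continuous.
- by have := ACE_valued_in s0 i; rewrite /= in_itv/= => /andP[].
move=> a b sa ab bt upos; have a0 := le_trans s0 sa.
have [_ ldu weak] := wdu a b a0 (le_trans a0 (ltW ab)) i.
apply: (@weak_derivative_le _ (fun x => u x i 0) (fun x => du x i 0)) => //.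
  exact: ACE_continuous.
apply: (@filterS _ _ (ae_filter_ringOfSetsType lebesgue_measure) _ _ _ aedu) => x.
rewrite in_itv/= => dux /andP[ax xb].
have x0 : 0 <= x by rewrite (le_trans a0)// ltW.
have [dx _] := dux x0 i.
apply: le_trans (dx _) (Dc x _); first by apply: upos; rewrite ax.
by rewrite (le_trans sa (ltW ax)) (le_trans (ltW xb)).
Qed.

Lemma ACE_ge i s t c : 0 <= s -> s <= t ->
  (forall x, s <= x <= t -> c <= D (u x) i 0) ->
  Num.min 1 (u s i 0 + c * (t - s)) <= u t i 0.
Proof.
move=> s0 st Dc; have [du wdu aedu] := ACE_derivative.
apply: (@upper_obstacle_slope_ge _ (fun x => u x i 0)) => //.
- exact: ACE_continuous.
- by have := ACE_valued_in s0 i; rewrite /= in_itv/= => /andP[].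
move=> a b sa ab bt upos; have a0 := le_trans s0 sa.
have [_ ldu weak] := wdu a b a0 (le_trans a0 (ltW ab)) i.
apply: (@weak_derivative_ge _ (fun x => u x i 0) (fun x => du x i 0)) => //.
  exact: ACE_continuous.
apply: (@filterS _ _ (ae_filter_ringOfSetsType lebesgue_measure) _ _ _ aedu) => x.
rewrite in_itv/= => dux /andP[ax xb].
have x0 : 0 <= x by rewrite (le_trans a0)// ltW.
have [_ dx] := dux x0 i.
apply: le_trans (Dc x _) (dx _); last by apply: upos; rewrite ax.
by rewrite (le_trans sa (ltW ax)) (le_trans (ltW xb)).
Qed.

(** The drift is bounded along the solution, and the truncations in [ACE_le] and [ACE_ge] cost
    nothing since [u s] already lies between 0 and 1. *)
Lemma ACE_lipschitz : exists2 K : R, 0 <= K &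
  forall s t, 0 <= s -> s <= t -> `|u t - u s| <= K * (t - s).
Proof.
have [K K0 Kb] := drift_bounded (opA w r mu) f eps_gt0.
exists K => // s t s0 st.
have Kts : 0 <= K * (t - s) by rewrite mulr_ge0// subr_ge0.
apply: mx_norm_le => // i j; rewrite ord1 !mxE.
have Dx x : s <= x <= t -> - K <= D (u x) i 0 <= K.
  move=> /andP[sx xt]; rewrite -ler_norml; apply: le_trans (mx_entry_le_norm _ _ _) _.
  exact/Kb/ACE_valued_in/(le_trans s0).
have := ACE_valued_in s0 i; rewrite /= in_itv/= => /andP[v0 v1].
have := @ACE_le i s t K s0 st; rewrite le_max => h1.
have := @ACE_ge i s t (- K) s0 st; rewrite ge_min => h2.
have {h1} h1 := h1 (fun x xst => proj2 (andP (Dx x xst))).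
have {h2} h2 := h2 (fun x xst => proj1 (andP (Dx x xst))).
rewrite ler_norml; apply/andP; split.
  by case/orP: h2 => h2; lra.
by case/orP: h1 => h1; lra.
Qed.

(** The drift is frozen at time [s]: between [s] and [t] it moves by at most [L * K * (t - s)], the
    product of the Lipschitz constants of the drift and of the solution. *)
Lemma ACE_step : exists2 C : R, 0 <= C & forall s t, 0 <= s -> s <= t -> forall i,
  u t i 0 <= Num.max 0 (u s i 0 + (t - s) * D (u s) i 0 + C * (t - s) ^+ 2) /\
  Num.min 1 (u s i 0 + (t - s) * D (u s) i 0 - C * (t - s) ^+ 2) <= u t i 0.
Proof.
have [K K0 lipu] := ACE_lipschitz.
have [L L0 lipD] := drift_lipschitz (opA w r mu) f eps_gt0.
exists (L * K) => [|s t s0 st i]; first by rewrite mulr_ge0.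
have DD x : s <= x <= t -> `|D (u x) i 0 - D (u s) i 0| <= L * K * (t - s).
  move=> /andP[sx xt].
  have -> : D (u x) i 0 - D (u s) i 0 = (D (u x) - D (u s)) i 0 by rewrite !mxE.
  apply: le_trans (mx_entry_le_norm _ _ _) _; apply: le_trans (lipD _ _) _.
  rewrite -mulrA ler_wpM2l//; apply: le_trans (lipu _ _ s0 sx) _.
  by rewrite ler_wpM2l// lerD2r.
have E c : (t - s) * D (u s) i 0 + c * (t - s) ^+ 2 = (D (u s) i 0 + c * (t - s)) * (t - s).
  by ring.
split.
- rewrite -addrA E; apply: ACE_le => // x /DD; rewrite ler_norml => /andP[_].
  by rewrite lerBlDr addrC.
- rewrite -addrA -mulNr E; apply: ACE_ge => // x /DD; rewrite ler_norml => /andP[+ _].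
  by rewrite lerBrDr addrC mulNr.
Qed.

End ACE.

(** * Accumulation of local errors *)

Section convergence.
Context {R : realType}.

(** Induction gives [e m <= (1 + L) ^+ m * (m%:R * C)], and [1 + L <= expR L]. *)
Lemma discrete_gronwall (L C : R) (e : nat -> R) : 0 <= L -> 0 <= C -> e 0%N <= 0 ->
  (forall m, e m.+1 <= (1 + L) * e m + C) ->
  forall m, e m <= C * m%:R * expR (L * m%:R).
Proof.
move=> L0 C0 e0 es m.
have L1 : 1 <= 1 + L by lra.
have : e m <= (1 + L) ^+ m * (m%:R * C).
  elim: m => [|m IH]; first by rewrite mul0r mulr0.
  apply: le_trans (es m) _.
  have h1 : (1 + L) * e m <= (1 + L) ^+ m.+1 * (m%:R * C).
    by rewrite exprS -mulrA ler_wpM2l//; lra.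
  have h2 : 1 * C <= (1 + L) ^+ m.+1 * C by rewrite ler_wpM2r// exprn_ege1.
  by rewrite -natr1; lra.
move=> /le_trans; apply; rewrite mulrC [C * _]mulrC.
rewrite ler_wpM2l ?mulr_ge0//.
by rewrite expRM_natr lerXn2r ?nnegrE ?expR_ge0//; [lra|exact: expR_ge1Dx].
Qed.

End convergence.

(** * Error at the grid times *)

Section error.
Context {R : realType} {n : nat}.
Variables (w : 'M[R]_n.+1) (r : R) (mu f : 'cV[R]_n.+1) (eps : R).
Variables (uhat betahat : R -> 'cV[R]_n.+1).
Hypotheses (eps_gt0 : 0 < eps) (Aunit : opA w r mu \in unitmx).
Hypothesis (uACE : ACE_solution w r mu f eps `[0, +oo[ uhat betahat).

(** The triple holds the step threshold, the Lipschitz constant of the drift and the sum of the two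
    local error constants. Solution and iterate both follow the same truncated Euler step up to
    order [tau ^+ 2], and truncation does not increase distances. *)
Lemma SDIE_error : exists tLC : R * R * R,
  [/\ 0 < tLC.1.1, 0 <= tLC.1.2, 0 <= tLC.2 &
    forall tau u beta, 0 < tau <= tLC.1.1 ->
    SDIE_iterates (opA w r mu) f eps tau (uhat 0) u beta ->
    forall m, `|uhat (m%:R * tau) - u m| <=
      tLC.2 * tau * (m%:R * tau) * expR (tLC.1.2 * (m%:R * tau))].
Proof.
have [[t1 C1] /= [t10 C10 Sstep]] := SDIE_step f eps_gt0 Aunit.
have [C2 C20 Astep] := ACE_step eps_gt0 uACE.
have [L L0 lipD] := drift_lipschitz (opA w r mu) f eps_gt0.
exists (t1, L, C1 + C2); split => //=; first by rewrite addr_ge0.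
move=> tau u beta tau1 [u0 us] m; have /andP[tau0 _] := tau1.
have u01 k : valued_in `[0, 1] (u k).
  case: k => [|k]; first by rewrite u0; apply: (ACE_valued_in uACE).
  by case: (us k) => _ [].
pose e k := `|uhat (k%:R * tau) - u k|.
have := @discrete_gronwall R (L * tau) ((C1 + C2) * tau ^+ 2) e _ _ _ _ m.
rewrite {2}/e.
have -> : (C1 + C2) * tau ^+ 2 * m%:R * expR (L * tau * m%:R) =
  (C1 + C2) * tau * (m%:R * tau) * expR (L * (m%:R * tau)).
  by rewrite -[L * tau * _]mulrA [tau * m%:R]mulrC; ring.
apply.
- by rewrite mulr_ge0// ltW.
- by rewrite mulr_ge0 ?sqr_ge0// addr_ge0.
- by rewrite /e mul0r u0 subrr normr0.
move=> k; have ktau : 0 <= k%:R * tau by rewrite mulr_ge0// ltW.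
have stepE : k.+1%:R * tau - k%:R * tau = tau by rewrite -natr1; ring.
have kk1 : k%:R * tau <= k.+1%:R * tau by rewrite -subr_ge0 stepE ltW.
have rhs0 : 0 <= (1 + L * tau) * e k + (C1 + C2) * tau ^+ 2.
  apply: addr_ge0; apply: mulr_ge0; rewrite ?normr_ge0 ?sqr_ge0 ?addr_ge0//.
  by rewrite mulr_ge0// ltW.
apply: mx_norm_le => // i j; rewrite ord1.
have [Ev vB] := us k.
have := Sstep tau (u k) (u k.+1) (beta k.+1) tau1 (u01 k) Ev vB i.
have := Astep _ _ ktau kk1 i; rewrite stepE le_max ge_min.
have := lipD (uhat (k%:R * tau)) (u k); rewrite -/(e k).
move=> /(le_trans (mx_entry_le_norm _ i 0)).
have := mx_entry_le_norm (uhat (k%:R * tau) - u k) i 0; rewrite -/(e k).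
have := ACE_valued_in uACE (le_trans ktau kk1) i; rewrite /= in_itv/= => /andP[v0 v1].
have := u01 k.+1 i; rewrite /= in_itv/= => /andP[z0 z1].
rewrite mxE [(- u k) i 0]mxE [(_ - _ : 'cV_n.+1) i 0]mxE [(- drift _ _ _ _) i 0]mxE.
rewrite [(_ - u k.+1) i 0]mxE [(- u k.+1) i 0]mxE.
move: (drift _ _ _ (uhat _) i 0) (drift _ _ _ (u k) i 0) => Da Db.
move: rhs0 v0 v1 z0 z1.
move: (uhat (k.+1%:R * tau) i 0) (u k.+1 i 0) (uhat (k%:R * tau) i 0) (u k i 0) => a' b' a b.
move: (e k) => ek rhs0 v0 v1 z0 z1.
rewrite !ler_norml => /andP[e1 e2] /andP[d1 d2] [A1 A2] [S1 S2].
have td1 := ler_wpM2l (ltW tau0) d1.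
have td2 := ler_wpM2l (ltW tau0) d2.
(* If one of the two new values sits at the obstacle that favours the inequality, the range of the
   other one settles it; otherwise the two Euler bounds are subtracted. *)
apply/andP; split.
- case/orP: A2 => A2; first by lra.
  by case: S2 => S2; lra.
- case/orP: A1 => A1; first by lra.
  by case: S1 => S1; lra.
Qed.

End error.

(** * Rounding up to the time grid, and passage to the limit *)

Lemma ceil_mul_bounds (R : realType) (t tau : R) : 0 <= t -> 0 < tau ->
  t <= `|Num.ceil (t / tau)|%N%:R * tau < t + tau.
Proof.
move=> t0 tau0; have x0 : 0 <= t / tau by rewrite divr_ge0// ltW.
have -> : `|Num.ceil (t / tau)|%N%:R = (Num.ceil (t / tau))%:~R :> R.
  by rewrite natr_absz ger0_norm// ceil_ge0// (lt_le_trans _ x0).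
rewrite -ler_pdivrMr// ceil_ge/= -ltr_pdivlMr// mulrDl divff ?gt_eqF//.
by have /andP[+ _] := ceil_itv (t / tau); rewrite intrB ltrBlDr.
Qed.

Theorem corollary2p18 (R : realType) (n : nat) (w : 'M[R]_n.+1) (r : R)
    (mu ftilde u0 : 'cV[R]_n.+1) (eps : R) (tau : nat -> R)
    (u beta : nat -> nat -> 'cV[R]_n.+1) (uhat betahat : R -> 'cV[R]_n.+1)
    (two_vertices : (2 <= n.+1)%N)
    (graph_w : weighted_connected_graph w)
    (r01 : 0 <= r <= 1)
    (mu_ge0 : valued_in `[0, +oo[ mu)
    (mu_neq0 : mu != 0)
    (ftilde01 : valued_in `[0, 1] ftilde)
    (u0_01 : valued_in `[0, 1] u0)
    (eps_gt0 : 0 < eps)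
    (eps_spec : ~ spectrum (opA w r mu) eps^-1)
    (tau_bounds : forall k, 0 < tau k < eps)
    (tau_noninc : nonincreasing_seq tau)
    (tau_cvg0 : tau @ \oo --> (0 : R))
    (uhat_ACE : ACE_solution w r mu (fidelity_mx mu *m ftilde) eps `[0, +oo[
                  uhat betahat)
    (uhat0 : uhat 0 = u0)
    (u_SDIE : forall k,
       SDIE_iterates (opA w r mu) (fidelity_mx mu *m ftilde) eps (tau k) u0
         (u k) (beta k)) :
  forall t : R, 0 <= t ->
    (fun k => u k `|Num.ceil (t / tau k)|%N) @ \oo --> uhat t.
Proof.
have Au : opA w r mu \in unitmx by exact: opA_unitmx.
have [K K0 lipu] := ACE_lipschitz eps_gt0 uhat_ACE.
have [[[t1 L] C] /= [t10 L0 C0 err]] := SDIE_error eps_gt0 Au uhat_ACE.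
(* [K] accounts for moving from [t] to the next grid time, the other term for the error there; the
   grid time stays below [t + 1] once [tau k <= 1]. *)
move=> t t0; pose B := K + C * (t + 1) * expR (L * (t + 1)).
have B0 : 0 <= B by rewrite addr_ge0// mulr_ge0 ?expR_ge0// mulr_ge0// addr_ge0.
apply/cvgrPdist_le => e e0; near=> k.
have /andP[tauk0 _] := tau_bounds k.
have tau_t1 : tau k <= t1 by near: k; exact: (cvgr_le _ tau_cvg0).
have tau_1 : tau k <= 1 by near: k; exact: (cvgr_le _ tau_cvg0).
(* [B + 1] is positive even when [B = 0]. *)
have tau_B : tau k <= e / (B + 1).
  by near: k; apply: (cvgr_le _ tau_cvg0); rewrite divr_gt0// ltr_wpDl.
have /andP[] := ceil_mul_bounds t0 tauk0; set m := `|_|%N => tm mt.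
have uk := u_SDIE k; rewrite -uhat0 in uk.
have := err (tau k) (u k) (beta k); rewrite tauk0 tau_t1 => /(_ isT uk m) errm.
rewrite -[uhat t](subrK (uhat (m%:R * tau k))) -addrA.
apply: le_trans (ler_normD _ _) _.
have h1 : `|uhat t - uhat (m%:R * tau k)| <= K * tau k.
  rewrite distrC; apply: le_trans (lipu _ _ t0 tm) _.
  by rewrite ler_wpM2l//; lra.
have h2 : C * tau k * (m%:R * tau k) * expR (L * (m%:R * tau k)) <=
    C * (t + 1) * expR (L * (t + 1)) * tau k.
  have mt1 : m%:R * tau k <= t + 1 by lra.
  have -> : C * (t + 1) * expR (L * (t + 1)) * tau k =
    C * tau k * (t + 1) * expR (L * (t + 1)) by ring.
  have Ct : 0 <= C * tau k by rewrite mulr_ge0// ltW.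
  apply: ler_pM; rewrite ?expR_ge0//.
  - by rewrite mulr_ge0// (le_trans t0).
  - by rewrite ler_wpM2l.
  - by rewrite ler_expR ler_wpM2l.
have : (B + 1) * tau k <= e by rewrite mulrC -ler_pdivlMr// ltr_wpDl.
by rewrite /B; lra.
Unshelve. all: by end_near. Qed.
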